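(* There exists a function $q:\mathbb{N}\to\mathbb{N}$, where $\mathbb{N}=\{1,2,3,\dots\}$, such that the function $n\mapsto q([\log n]+1)$ on $\mathbb{N}$ is a super-polynomial and \[\limsup_{n\rightarrow\infty} r\left((2n+1)^2, q(n)\right)<\infty,\] where $r(\cdot,\cdot)$ denotes the opposite-Ramsey number.
   Context: $\mathbb{N}$ is the set of positive integers, $\log$ is the natural logarithm, and $[x]$ is the integer part of a real number $x\ge 0$. Opposite-Ramsey number: for positive integers $p$ and $q$, $r(p,q)$ is the maximal number $k$ such that every edge-coloring of the complete graph $K_q$ on $q$ vertices with $p$ colors yields a monochromatic complete subgraph of order $k$ (the order of a graph is the number of its vertices). An edge-coloring is an arbitrary assignment of one of the $p$ colors to each edge. Super-polynomial: a function $f:\mathbb{N}\to\mathbb{R}$ such that for every (not identically zero) polynomial $g$ with real coefficients, $\liminf_{n\to\infty}\frac{|f(n)|}{|g(n)|}=\infty$ (the quotient is defined for all sufficiently large $n$). *)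

(* Defs.v *)
From mathcomp Require Import all_boot all_order all_algebra.
From mathcomp Require Import all_classical all_reals all_analysis.
Set Implicit Arguments.
Unset Strict Implicit.
Unset Printing Implicit Defensive.
Import Order.TTheory GRing.Theory Num.Theory.
Local Open Scope nat_scope.

(* The edges of K_q are the 2-element subsets of its vertex set 'I_q. *)
Notation edge q := {e : {set 'I_q} | #|e| == 2}.

Notation edge_coloring p q := {ffun edge q -> 'I_p}.

Definition monochromatic (p q : nat) (c : edge_coloring p q) (S : {set 'I_q}) :
    bool :=
  [exists i : 'I_p, forall e : edge q, (val e \subset S) ==> (c e == i)].

Definition forces_mono (p q k : nat) : bool :=
  [forall c : edge_coloring p q,
    exists S : {set 'I_q}, (#|S| == k) && monochromatic c S].

(* A subgraph of K_q has order at most q, so bounding k by q loses nothing;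
   see opp_ramsey_max. *)
Definition opp_ramsey (p q : nat) : nat :=
  \max_(k < q.+1 | forces_mono p q k) k.

Lemma forces_mono_le (p q k : nat) : 0 < p -> forces_mono p q k -> k <= q.
Proof.
move=> p_gt0 /forallP/(_ [ffun=> Ordinal p_gt0])/existsP[S /andP[/eqP<- _]].
by rewrite -[leqRHS]card_ord max_card.
Qed.

Lemma opp_ramsey_max (p q : nat) : 0 < p ->
  forces_mono p q (opp_ramsey p q) /\
  (forall k, forces_mono p q k -> k <= opp_ramsey p q).
Proof.
move=> p_gt0; split=> [|k fk].
  have f0 : forces_mono p q (@ord0 q).
    apply/forallP=> c; apply/existsP; exists finset.set0.
    rewrite cards0 eqxx; apply/existsP; exists (Ordinal p_gt0).
    apply/forallP=> e; apply/implyP; rewrite finset.subset0 => /eqP e0.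
    by have := valP e; rewrite e0 cards0.
  rewrite /opp_ramsey (bigop.bigmax_eq_arg ord0) //.
  by case: arg_maxnP.
have k_lt : k < q.+1 by rewrite ltnS (forces_mono_le p_gt0).
exact: (leq_bigmax_cond (Ordinal k_lt)).
Qed.

Local Open Scope ring_scope.

(* As x / 0 = 0, the sequence below is total; it takes junk values only at the
   finitely many zeros of g and at 0, which do not affect the inferior limit. *)
Definition super_polynomial (R : realType) (f : nat -> R) : Prop :=
  forall g : {poly R}, g != 0 ->
    limn_einf (fun n : nat => (`|f n| / `|g.[n%:R]|)%:E) = +oo%E.

(* Main.v *)
Require Import Defs.
From mathcomp Require Import all_boot all_order all_algebra.
From mathcomp Require Import all_classical all_reals all_analysis.
From mathcomp Require polyrcf.
Import Order.TTheory GRing.Theory Num.Theory.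
Local Open Scope ring_scope.

(* Label the vertices of K_(2 ^ p) by the subsets of the p colours and give an
   edge a colour on which the labels of its two ends disagree. Every colour
   class is bipartite, hence triangle-free, so r(p, 2 ^ p) <= 2. Take
   q(n) = 2 ^ ((2n+1)^2): for m = [log n] + 1 one has n < e^m <= 4^m, so that
   q(m) >= n^m, whose exponent m tends to infinity with n. *)

Lemma opp_ramsey_le2 (p q : nat) :
  (0 < p)%N -> (q <= 2 ^ p)%N -> (opp_ramsey p q <= 2)%N.
Proof.
move=> p_gt0 le_q.
have le_q_card : (q <= #|{: {set 'I_p}}|)%N.
  by rewrite -cardsT -powersetT card_powerset cardsT card_ord.
pose f (v : 'I_q) : {set 'I_p} := enum_val (widen_ord le_q_card v).
have f_inj : injective f.
  by move=> v w /enum_val_inj/(congr1 val)/= eq_vw; exact: val_inj.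
pose differ (e : {set 'I_q}) (i : 'I_p) :=
  [exists v in e, exists w in e, (i \in f v) != (i \in f w)].
(* The default colour only makes [c] total: the ends of an edge have distinct labels, so some colour
   always separates them. *)
pose c : edge_coloring p q :=
  [ffun e : edge q => odflt (Ordinal p_gt0) [pick i | differ (val e) i]].
have c_neq (S : {set 'I_q}) (i : 'I_p) v w :
    (forall e : edge q, val e \subset S -> c e = i) ->
    v \in S -> w \in S -> v != w -> (i \in f v) != (i \in f w).
  move=> monoS vS wS vw.
  have e2 : #|[set v; w]%SET| == 2 by rewrite cards2 vw.
  have := monoS (exist _ [set v; w]%SET e2).
  rewrite ffunE /= finset.subUset !finset.sub1set vS wS => /(_ isT).
  case: pickP => [j /existsP[a /andP[va /existsP[b /andP[vb ab]]]] /= <-|nodiff _].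
    move: va vb ab; rewrite !inE.
    move=> /orP[]/eqP-> /orP[]/eqP->; rewrite ?eqxx//.
    by rewrite eq_sym.
  case/eqP: vw; apply/f_inj/setP => j; apply/eqP/negP => /negP jvw.
  have /negP[] := negbT (nodiff j).
  apply/existsP; exists v; rewrite !inE eqxx /=.
  by apply/existsP; exists w; rewrite !inE eqxx orbT.
apply/bigmax_leqP => k /forallP/(_ c)/existsP[S /andP[/eqP <-]].
move=> /existsP[i /forallP monoS]; rewrite leqNgt; apply/negP => /card_gt2P.
move=> [x [y [z [[xS yS zS] [xy yz zx]]]]].
have {}monoS (e : edge q) : val e \subset S -> c e = i by move/(implyP (monoS e))/eqP.
(* Three truth values cannot be pairwise distinct. *)
have := c_neq S i _ _ monoS xS yS xy.
have := c_neq S i _ _ monoS yS zS yz.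
have := c_neq S i _ _ monoS zS xS zx.
by case: (i \in f x); case: (i \in f y); case: (i \in f z).
Qed.

(** From [1 + x <= expR x] at x = -1/2 one gets e^(1/2) <= 2; then square. *)
Lemma expR1_le4 (R : realType) : expR 1 <= 4 :> R.
Proof.
have := expR_ge1Dx (- (2^-1) : R).
have -> : 1 - 2^-1 = 2^-1 :> R by rewrite {1}[1]splitr mul1r addrK.
rewrite expRN lef_pV2 ?posrE ?expR_gt0// => le2.
have -> : 4 = 2 * 2 :> R by rewrite -natrM.
rewrite [X in expR X](splitr 1) mul1r expRD.
by apply: ler_pM; rewrite ?expR_ge0.
Qed.

(** Triangle inequality, with each power of x raised to the exponent [size g], which for nonzero g
    is one above the degree. *)
Lemma normr_horner_le (R : realDomainType) (g : {poly R}) (x : R) :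
  1 <= x -> `|g.[x]| <= (\sum_(i < size g) `|g`_i|) * x ^+ size g.
Proof.
move=> x1; rewrite horner_coef mulr_suml.
apply: le_trans (ler_norm_sum _ _ _) _; apply: ler_sum => i _.
rewrite normrM normrX (ger0_norm (le_trans ler01 x1)).
by rewrite ler_wpM2l// ler_weXn2l// ltnW.
Qed.

Lemma super_polynomial_witness (R : realType) :
  super_polynomial (fun n : nat =>
    (2 ^ (2 * (Num.truncn (ln (n%:R : R)) + 1) + 1) ^ 2)%N%:R : R).
Proof.
move=> g g0; set u := (X in limn_einf X).
(* A convergent sequence has its limit as inferior limit. *)
suff u_cvg : (u n @[n --> \oo] --> +oo)%classic%E.
  by rewrite is_cvg_limn_einfE; [exact/cvg_lim|apply/cvg_ex; exists +oo%E].
apply/cvgeryP/cvgryPge => A.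
pose C : R := \sum_(i < size g) `|g`_i|.
near=> n.
have n1 : 1 <= n%:R :> R by near: n; exact: nbhs_infty_ger.
have n0 : 0 < n%:R :> R := lt_le_trans ltr01 n1.
have nd : expR (size g)%:R <= n%:R :> R by near: n; exact: nbhs_infty_ger.
have nA : A * C <= n%:R by near: n; exact: nbhs_infty_ger.
(* Beyond its Cauchy bound g has no root, so the quotient is a genuine one. *)
have gn0 : 0 < `|g.[n%:R]|.
  rewrite normr_gt0; apply: (polyrcf.ge_cauchy_bound g0).
  by rewrite in_itv /= andbT; near: n; exact: nbhs_infty_ger.
set m := (Num.truncn (ln (n%:R : R)) + 1)%N.
have ln_lt : ln n%:R < m%:R :> R by rewrite /m addn1 truncnS_gt.
have dm : (size g < m)%N.
  rewrite -(ltr_nat R); apply: le_lt_trans ln_lt.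
  by rewrite -ler_expR lnK.
have nm : n%:R <= 4 ^+ m :> R.
  rewrite -[n%:R]lnK ?posrE//; apply: le_trans (_ : expR (m%:R * 1) <= _).
    by rewrite ler_expR mulr1 ltW.
  by rewrite mulrC expRM_natr lerXn2r ?nnegrE ?expR_ge0// expR1_le4.
rewrite ler_pdivlMr//.
(* The estimate of |g(n)| can be multiplied by A only when A >= 0; a negative A is trivial. *)
have [A0|A0] := ltP A 0.
  by apply: le_trans (_ : 0 <= _); rewrite ?mulr_le0_ge0 ?(ltW A0).
(* With d = [size g], the chain is A |g(n)| <= A C n^d <= n^(d+1) <= n^m <= 4^(m^2) <= 2^((2m+1)^2);
   its second step uses A C <= n, its third d < m. *)
apply: le_trans (_ : A * (C * n%:R ^+ size g) <= _).
  by rewrite ler_wpM2l// normr_horner_le.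
apply: le_trans (_ : n%:R ^+ m <= _).
  rewrite mulrA; apply: le_trans (_ : n%:R * n%:R ^+ size g <= _).
    by rewrite ler_wpM2r// exprn_ge0// ltW.
  by rewrite -exprS ler_weXn2l.
rewrite ger0_norm//; apply: le_trans (_ : (4 ^+ m) ^+ m <= _).
  by rewrite lerXn2r ?nnegrE ?exprn_ge0// ltW.
have -> : 4 = 2 ^+ 2 :> R by rewrite -natrX.
rewrite -!exprM -natrX ler_nat leq_exp2l//.
rewrite mulnA -mulnn leq_mul ?leq_addr//.
by rewrite (leq_trans (leq_pmull m (isT : 0 < 2)%N)) ?leq_addr.
Unshelve. all: by end_near. Qed.

Theorem theorem2p1 (R : realType) :
  exists q : nat -> nat,
    [/\ (forall n : nat, (0 < n)%N -> (0 < q n)%N),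
        super_polynomial
          (fun n : nat => (q (Num.truncn (ln (n%:R : R)) + 1)%N)%:R : R)
      & (limn_esup (fun n : nat =>
           ((opp_ramsey ((2 * n + 1) ^ 2) (q n))%:R : R)%:E) < +oo)%E].
Proof.
exists (fun n => 2 ^ (2 * n + 1) ^ 2)%N; split.
- by move=> n _; rewrite expn_gt0.
- exact: super_polynomial_witness.
- apply: (@le_lt_trans _ _ (2%:R : R)%:E); last exact: ltry.
  (* The superior limit is an infimum of suprema over sets of the filter; the whole of [nat]
     suffices, since every term is at most 2. *)
  rewrite /limn_esup limf_esupE; apply: ereal_inf_le.
  eexists; first by exists setT; [exact: filterT|reflexivity].
  apply: ge_ereal_sup => _ [n _ <-]; rewrite lee_fin ler_nat.
  by rewrite opp_ramsey_le2// expn_gt0 addn1.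
Qed.
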